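(* For every infinite cardinal $\kappa$ there is a hereditarily indecomposable continuum $K$ of weight $\kappa$, and $K$ admits an essential map onto the Tychonoff cube $[0,1]^\kappa$.
   Context: A continuum is a compact connected Hausdorff space. A compact Hausdorff space is hereditarily indecomposable if whenever two subcontinua of it meet, one of them is contained in the other. For disjoint closed sets $A,B$ in a space $Z$, a closed set $L$ is a partition between $A$ and $B$ if $Z\setminus L=U\cup V$ with $U,V$ disjoint open sets, $A\subseteq U$, $B\subseteq V$. A family $\{(A_i,B_i):i\in I\}$ of pairs of disjoint closed sets is essential if whenever $L_i$ is a partition between $A_i$ and $B_i$ for each $i\in I$, the intersection $\bigcap_{i\in I}L_i$ is nonempty. For $\alpha<\kappa$ let $A_\alpha=\{x\in[0,1]^\kappa:x_\alpha=0\}$ and $B_\alpha=\{x\in[0,1]^\kappa:x_\alpha=1\}$. A continuous map $f:K\to[0,1]^\kappa$ is essential if the family $\{(f^{-1}[A_\alpha],f^{-1}[B_\alpha]):\alpha<\kappa\}$ is essential in $K$. *)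

(* Defs.v *)
From HB Require Import structures.
From mathcomp Require Import all_boot all_order all_algebra.
From mathcomp Require Import all_classical all_reals all_analysis.
Import numFieldNormedType.Exports.
Set Implicit Arguments. Unset Strict Implicit. Unset Printing Implicit Defensive.
Import Order.TTheory GRing.Theory Num.Theory.
Local Open Scope classical_set_scope.
Local Open Scope ring_scope.

Definition continuum (K : topologicalType) : Prop :=
  compact [set: K] /\ connected [set: K] /\ hausdorff_space K.

Definition subcontinuum (K : topologicalType) (C : set K) : Prop :=
  compact C /\ connected C.

Definition hereditarily_indecomposable (K : topologicalType) : Prop :=
  forall C D : set K, subcontinuum C -> subcontinuum D ->
    C `&` D !=set0 -> C `<=` D \/ D `<=` C.

Definition has_weight (K : topologicalType) (I : Type) : Prop :=
  (exists2 B : set (set K), (B #<= [set: I])%card & basis B) /\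
  (forall B : set (set K), basis B -> ([set: I] #<= B)%card).

Definition cube (R : realType) (I : Type) : set ({ptws I -> R}) :=
  [set x | forall i, (0 <= x i)%R /\ (x i <= 1)%R].

Definition partition_between (Z : topologicalType) (A B L : set Z) : Prop :=
  closed L /\ exists U V : set Z,
    [/\ open U /\ open V, U `&` V = set0, ~` L = U `|` V, A `<=` U & B `<=` V].

Definition essential_family (Z : topologicalType) (J : Type) (A B : J -> set Z)
  : Prop :=
  (forall j, [/\ closed (A j), closed (B j) & (A j `&` B j = set0)]) /\
  forall L : J -> set Z, (forall j, partition_between (A j) (B j) (L j)) ->
    \bigcap_j L j !=set0.

Definition essential_map (R : realType) (K : topologicalType) (I : Type)
  (f : K -> {ptws I -> R}) : Prop :=
  essential_family (fun a : I => f @^-1` [set x | x a = 0])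
                   (fun a : I => f @^-1` [set x | x a = 1]).

(* Main.v *)
(* Krasinkiewicz and Minc: a compact space is hereditarily indecomposable as soon
   as it is folded like the letter Z between any two disjoint closed sets.  In the
   cube [0,1]^(I + I) such a fold is imposed by a partition between two opposite
   faces: if [g] is a real function and [t] a coordinate, the preimage under (g, t)
   of a Z-shaped broken line is a partition between {t = 0} and {t = 1}.  The
   coordinates [inr a] are spent on folds along functions [g] that separate
   points, of which |I| many suffice; opposite faces of a cube being an essential
   family, the pairs of faces with index [inl i] remain essential on the
   intersection of all the folds, and a minimal closed set on which they are
   essential is a continuum.  Its projection to the coordinates [inl i] is the
   required map.  That faces are essential is proved with Kuhn's cubical Sperner
   lemma, obtained by a mod 2 cup product computation. *)
Require Import Defs.
From HB Require Import structures.
From mathcomp Require Import all_boot all_order all_algebra finmap.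
From mathcomp Require Import all_classical all_reals all_analysis.
From mathcomp Require Import ring lra zify.
Import numFieldNormedType.Exports.
Import Order.TTheory GRing.Theory Num.Theory.
Set Implicit Arguments.
Unset Strict Implicit.
Unset Printing Implicit Defensive.
Local Open Scope ring_scope.

(** * Kuhn's cubical lemma *)

Section CubicalCupProduct.
Variables (I : finType) (R : comNzRingType).
Hypothesis char2 : forall x : R, x + x = 0.

Implicit Types (v w : I -> nat) (d : I) (D : {set I}) (f g : (I -> nat) -> R).

Let oppE (x : R) : - x = x.
Proof. by apply/eqP; rewrite eq_sym -subr_eq0 opprK char2. Qed.

Definition bumpv v d : I -> nat := fun i => (v i + (i == d))%N.

Definition setv v d m : I -> nat := fun i => if i == d then m else v i.

(** Cup product of the coboundaries of the functions [fs], evaluated on the lattice cube with lowest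
    corner [v] and edge directions [D]. With as many functions as directions it sums, over all
    monotone edge paths from [v] to the opposite corner, the product of the increments. Signs are
    left out in view of characteristic 2. *)
Fixpoint cup (fs : seq ((I -> nat) -> R)) v D : R :=
  if fs is f :: fs' then
    \sum_(d in D) (f (bumpv v d) - f v) * cup fs' (bumpv v d) (D :\ d)
  else 1.

Lemma bumpvC v d e : bumpv (bumpv v d) e = bumpv (bumpv v e) d.
Proof. by apply/funext => i; rewrite /bumpv addnAC. Qed.

(** Every unordered pair contributes twice, hence nothing in characteristic 2. *)
Lemma sum_sym_offdiag D (h : I -> I -> R) :
  (forall d e, h d e = h e d) -> \sum_(d in D) \sum_(e in D :\ d) h d e = 0.
Proof.
move=> hC.
have diag (s : seq I) : \sum_(d <- s) \sum_(e <- s) h d e = \sum_(d <- s) h d d.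
  elim: s => [|a s IH]; first by rewrite !big_nil.
  rewrite !big_cons; under [X in _ + X]eq_bigr do rewrite big_cons.
  rewrite big_split /= IH -addrA; congr (_ + _); rewrite addrA.
  by under eq_bigr do rewrite hC; rewrite char2 add0r.
apply/eqP; have /eqP := diag (enum D).
rewrite big_enum /=; under eq_bigr => d dD.
  rewrite big_enum /= (big_setD1 d) //=; over.
by rewrite big_split /= big_enum /= addrC -subr_eq0 addrK.
Qed.

(** A cup product of coboundaries is a cocycle. By induction on [fs]: of the four double sums that
    arise, one is symmetric in [d] and [e], one becomes so by the induction hypothesis, and the
    other two combine to the induction hypothesis for the facet at [bumpv v d]. *)
Lemma cup_closed fs v D :
  \sum_(d in D) (cup fs (bumpv v d) (D :\ d) + cup fs v (D :\ d)) = 0.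
Proof.
elim: fs v D => [|f fs IH] v D /=; first by under eq_bigr do rewrite char2; rewrite big1.
pose c d e := cup fs (bumpv (bumpv v d) e) (D :\ d :\ e).
pose h d e := cup fs v (D :\ d :\ e).
have cC d e : c d e = c e d.
  by rewrite /c bumpvC; congr (cup _ _ _); rewrite !finset.setDDl finset.setUC.
have hC d e : h d e = h e d.
  by rewrite /h; congr (cup _ _ _); rewrite !finset.setDDl finset.setUC.
pose k d e := cup fs (bumpv v e) (D :\ d :\ e).
transitivity (\sum_(d in D) \sum_(e in D :\ d)
    (f (bumpv (bumpv v d) e) * c d e + (f (bumpv v d) * c d e
    + (f (bumpv v e) * k d e + f v * k d e)))).
  apply: eq_bigr => d dD; rewrite -big_split /=; apply: eq_bigr => e eD.
  by rewrite /c /k !mulrBl !oppE !addrA.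
under eq_bigr do rewrite big_split /=.
rewrite big_split /= sum_sym_offdiag ?add0r; last by move=> d e; rewrite cC bumpvC.
under eq_bigr do rewrite big_split /=.
rewrite big_split /=.
under [X in _ + X]eq_bigr do rewrite big_split /=.
rewrite [X in _ + X]big_split /=.
have IHk d : \sum_(e in D :\ d) k d e = \sum_(e in D :\ d) h d e.
  by apply/eqP; rewrite -subr_eq0 oppE -big_split /= IH.
have -> : \sum_(d in D) \sum_(e in D :\ d) f v * k d e = 0.
  under eq_bigr do rewrite -mulr_sumr IHk.
  by rewrite -mulr_sumr sum_sym_offdiag ?mulr0.
rewrite addr0.
have -> : \sum_(d in D) \sum_(e in D :\ d) f (bumpv v e) * k d e =
          \sum_(d in D) \sum_(e in D :\ d) f (bumpv v d) * k e d.
  rewrite (exchange_big_dep (mem D)) /=; last by move=> d e _; rewrite !inE => /andP[].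
  apply: eq_bigr => d dD; apply: eq_bigl => e.
  by rewrite !inE dD andbT andbC eq_sym.
rewrite -big_split /= big1 // => d dD; rewrite -big_split /=.
transitivity (f (bumpv v d) * \sum_(e in D :\ d) (c d e + k e d)).
  by rewrite mulr_sumr; apply: eq_bigr => e _; rewrite mulrDr.
rewrite [X in _ * X](_ : _ = 0) ?mulr0 // -[RHS](IH (bumpv v d) (D :\ d)).
by apply: eq_bigr => e _; rewrite /c /k !finset.setDDl [X in D :\: X]finset.setUC.
Qed.

(* The discrete Leibniz rule: a cup product of coboundaries is a coboundary. *)
Lemma cup_cons f fs v D :
  cup (f :: fs) v D = \sum_(d in D)
    (f (bumpv v d) * cup fs (bumpv v d) (D :\ d) - f v * cup fs v (D :\ d)).
Proof.
rewrite /=; have := cup_closed fs v D; rewrite big_split /=.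
move/eqP; rewrite -{1}[X in _ + X]oppE subr_eq0 => /eqP cupE.
under eq_bigr do rewrite mulrBl.
by rewrite !sumrB -!mulr_sumr cupE.
Qed.

(** All edge paths that are counted stay in the hyperplane [w d = m], where [f] has no
    increments. *)
Lemma cup_const fs v D d m c f : f \in fs -> d \notin D -> v d = m ->
  (forall w, w d = m -> f w = c) -> cup fs v D = 0.
Proof.
move=> + + + fc; elim: fs v D => // g fs IH v D /=.
rewrite inE => /predU1P[<-|ffs] dD vd; apply: big1 => e eD.
  have ed : (d == e) = false by apply: contraNF dD => /eqP->.
  by rewrite !fc ?subrr ?mul0r // /bumpv vd ed addn0.
have ed : (d == e) = false by apply: contraNF dD => /eqP->.
by rewrite IH ?mulr0 // ?inE ?negb_and ?dD ?orbT // /bumpv vd ed addn0.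
Qed.

(** Some path contributes a nonzero product, so each function in [fs] changes its value along an
    edge of that path. *)
Lemma cup_neq0 fs v D f : f \in fs -> cup fs v D != 0 ->
  exists w w', [/\ forall i, (v i <= w i <= (v i).+1)%N,
                   forall i, (v i <= w' i <= (v i).+1)%N & f w != f w'].
Proof.
move=> ffs c0.
(* The induction needs the sharper bound by [D]: each direction is used up once a path has followed
   it, so no coordinate is raised twice. *)
suff [w [w' [wE w'E fww']]] : exists w w', [/\
    forall i, (v i <= w i <= v i + (i \in D))%N,
    forall i, (v i <= w' i <= v i + (i \in D))%N & f w != f w'].
  exists w, w'; split => // i; [have := wE i|have := w'E i]; case: (i \in D); lia.
elim: fs v D ffs c0 => // g fs IH v D; rewrite inE => ffs /= c0.
have [d dD d0] : exists2 d, d \in D & (g (bumpv v d) - g v) * cup fs (bumpv v d) (D :\ d) != 0.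
  apply/exists_inP; apply: contraNT c0 => /exists_inPn d0.
  by rewrite big1 // => d dD; apply/eqP; move: (d0 d dD); rewrite negbK.
move: ffs => /predU1P[->|ffs].
  exists (bumpv v d), v; split => [i|i|].
  - by rewrite /bumpv; case: (i =P d) => [->|]; rewrite ?dD //=; lia.
  - lia.
  - by apply: contraNneq d0 => ->; rewrite subrr mul0r.
have {}/(IH _ _ ffs)[w [w' [wE w'E fww']]] : cup fs (bumpv v d) (D :\ d) != 0.
  by apply: contraNneq d0 => ->; rewrite mulr0.
exists w, w'; split => // i; [move: (wE i)|move: (w'E i)]; rewrite /bumpv !inE;
  by case: (i =P d) => [->|_]; rewrite ?dD /=; lia.
Qed.

(** * Sums over the cells of a grid *)

Fixpoint gridsum (N : nat) (s : seq I) (g : (I -> nat) -> R) v : R :=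
  if s is d :: s' then \sum_(t < N) gridsum N s' g (setv v d t) else g v.

Lemma eq_gridsum N s f g v : f =1 g -> gridsum N s f v = gridsum N s g v.
Proof.
by move=> fg; elim: s v => //= d s IH v; apply: eq_bigr => t _; exact: IH.
Qed.

Lemma gridsum_sum N s (J : Type) (r : seq J) (g : J -> (I -> nat) -> R) v :
  gridsum N s (fun w => \sum_(j <- r) g j w) v = \sum_(j <- r) gridsum N s (g j) v.
Proof.
elim: s v => //= d s IH v; rewrite exchange_big /=.
by apply: eq_bigr => t _; exact: IH.
Qed.

Lemma setvC v d e m k : d != e -> setv (setv v d m) e k = setv (setv v e k) d m.
Proof.
move=> de; apply/funext => i; rewrite /setv.
by case: (i =P e) => // ->; rewrite eq_sym (negbTE de).
Qed.

Lemma gridsum_setv N s g v d m : d \notin s ->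
  gridsum N s g (setv v d m) = gridsum N s (fun w => g (setv w d m)) v.
Proof.
elim: s v => //= e s IH v; rewrite inE negb_or => /andP[de ds].
by apply: eq_bigr => t _; rewrite setvC // IH.
Qed.

Lemma gridsum_telescope N s g v d : uniq s -> d \in s ->
  gridsum N s (fun w => g (bumpv w d) - g w) v =
  gridsum N (rem d s) (fun w => g (setv w d N) - g (setv w d 0)) v.
Proof.
elim: s v => //= e s IH v /andP[es us]; rewrite inE eq_sym.
have [ed _|ed /= ds] := eqVneq e d; last by apply: eq_bigr => t _; exact: IH.
subst d; under eq_bigr do rewrite gridsum_setv //.
rewrite -big_enum -gridsum_sum; apply: eq_gridsum => w.
rewrite big_enum /= -(telescope_sumr (fun t => g (setv w e t)) (leq0n N)) big_mkord.
apply: eq_bigr => t _; congr (g _ - _); apply/funext => i.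
by rewrite /bumpv /setv; case: (i =P e) => _; rewrite ?addn1 ?addn0.
Qed.

Lemma gridsum0 N s v : gridsum N s (fun=> 0) v = 0.
Proof. by elim: s v => //= d s IH v; rewrite big1. Qed.

(** By the Leibniz rule the summand is a coboundary, so the sum reduces to the boundary of the grid.
    On the faces orthogonal to a direction [e] other than the first one [d], the function [f e] is
    constant and annihilates the product. Orthogonally to [d], the face at 0 vanishes with [f d],
    and the face at [N] reproduces the claim with one direction fewer. *)
Lemma gridsum_cup N (f : I -> (I -> nat) -> R) s v : uniq s ->
  (forall i w, w i = 0%N -> f i w = 0) -> (forall i w, w i = N -> f i w = 1) ->
  gridsum N s (fun w => cup [seq f i | i <- s] w [set i in s]) v = 1.
Proof.
move=> + f0 f1; elim: s v => [//|d s IH] v us.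
pose G e w := f d w * cup [seq f i | i <- s] w ([set i in d :: s] :\ e).
transitivity (gridsum N (d :: s) (fun w => \sum_(e <- d :: s) (G e (bumpv w e) - G e w)) v).
  apply: eq_gridsum => w; rewrite map_cons cup_cons (big_uniq _ us) /=.
  by apply: eq_bigl => e; rewrite inE.
rewrite gridsum_sum big_seq.
under eq_bigr => e eds do rewrite gridsum_telescope //.
rewrite -big_seq big_cons.
have /andP[ds {}us] : (d \notin s) && uniq s := us.
have dE : [set i in d :: s] :\ d = [set i in s].
  by apply/setP => i; rewrite !inE; case: eqVneq => //= ->; rewrite (negbTE ds).
rewrite [X in X + _](_ : _ = 1) ?[X in _ + X]big1_seq ?addr0 //.
  move=> e /= es.
  rewrite (@eq_gridsum _ _ _ (fun=> 0)).
    exact: gridsum0.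
  move=> w; suff cupE m c : (forall w', w' e = m -> f e w' = c) ->
      cup [seq f i | i <- s] (setv w e m) ([set i in d :: s] :\ e) = 0.
    by rewrite /G (cupE _ _ (f1 e)) (cupE _ _ (f0 e)) !mulr0 subrr.
  move=> fe; apply: (cup_const (map_f f es) _ _ fe); first by rewrite !inE eqxx.
  by rewrite /setv eqxx.
rewrite /= eqxx -[RHS](IH (setv v d N) us) gridsum_setv //.
apply: eq_gridsum => w; rewrite /G f1; last by rewrite /setv eqxx.
by rewrite f0 ?mul0r ?subr0 ?mul1r ?dE // /setv eqxx.
Qed.

End CubicalCupProduct.

Lemma gridsum_neq0 (I : finType) (R : comNzRingType) N s (g : (I -> nat) -> R) v :
  gridsum N s g v != 0 -> exists2 w : I -> nat, g w != 0 &
    forall i, if i \in s then (w i < N)%N else w i == v i.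
Proof.
elim: s v => [|d s IH] v /=; first by exists v.
move=> g0; have [t _ {}/IH [w w0 wE]] : exists2 t : 'I_N, true & gridsum N s g (setv v d t) != 0.
  apply/exists_inP; apply: contraNT g0 => /exists_inPn t0.
  by rewrite big1 // => t _; apply/eqP; move: (t0 t isT); rewrite negbK.
exists w => // i; move: (wE i); rewrite inE /setv.
by case: (i \in s); rewrite ?orbT ?orbF //; case: (i =P d) => // _ /eqP->.
Qed.

(** Read in the field with two elements, the [f i] have a cup product with total 1 over all cells.
    It is therefore nonzero on some cell, and there every [f i] takes both values. *)
Lemma kuhn_cube (I : finType) (N : nat) (f : I -> (I -> nat) -> bool) :
  (forall i w, w i = 0%N -> ~~ f i w) -> (forall i w, w i = N -> f i w) ->
  exists v : I -> nat, (forall i, (v i < N)%N) /\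
    forall i, exists w w', [/\ forall j, (v j <= w j <= (v j).+1)%N,
      forall j, (v j <= w' j <= (v j).+1)%N, f i w & ~~ f i w'].
Proof.
move=> f0 f1; have char2 (x : 'F_2) : x + x = 0.
  by rewrite -mulr2n -mulr_natr pchar_Zp ?mulr0.
pose F i w : 'F_2 := (f i w)%:R.
have F0 i w : w i = 0%N -> F i w = 0 by rewrite /F => /f0 /negbTE ->.
have F1 i w : w i = N -> F i w = 1 by rewrite /F => /f1 ->.
have := gridsum_cup char2 (fun=> 0%N) (enum_uniq I) F0 F1.
have -> : [set i in enum I] = finset.setT by apply/setP => i; rewrite !inE mem_enum.
move=> S1; have /gridsum_neq0 [v v0 vN] : gridsum N (enum I)
    (fun w => cup [seq F i | i <- enum I] w finset.setT) (fun=> 0%N) != 0.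
  by rewrite S1 oner_eq0.
exists v; split=> [i|i]; first by have := vN i; rewrite mem_enum.
have [|w [w' [wv w'v]]] := cup_neq0 (f := F i) _ v0.
  by rewrite map_f // mem_enum.
rewrite /F => fww'; case fw: (f i w); case fw': (f i w'); move: fww'; rewrite fw fw' ?eqxx //.
  by exists w, w'; rewrite fw fw'.
by exists w', w; rewrite fw fw'.
Qed.

Local Open Scope classical_set_scope.
Local Open Scope ring_scope.

(** * Cardinal arithmetic *)

Lemma card_le_injP (T U : Type) (A : set T) (f : T -> U) (B : set U) :
  (forall x, A x -> B (f x)) -> set_inj A f -> (A #<= B)%card.
Proof.
move=> AB fI; apply/card_leP.
have fAB : forall x : A, f (val x) \in B by move=> x; apply/mem_set/AB/set_valP.
apply/injfunPex; exists (fun x : A => exist _ (f (val x)) (fAB x)) => //.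
move=> x y _ _ /(congr1 val)/= xy; apply/val_inj/fI => //; by apply/mem_set/set_valP.
Qed.

Lemma card_le_inj (T U : Type) (A : set T) (B : set U) (u : U) : (A #<= B)%card ->
  exists2 f : T -> U, forall x, A x -> B (f x) & set_inj A f.
Proof.
move=> /card_leP[f].
exists (fun x => if pselect (A x) is left Ax then val (f (exist _ x (mem_set Ax))) else u).
  move=> x Ax; case: pselect => // Ax'; exact: set_valP.
move=> x y /set_mem Ax /set_mem Ay; case: pselect => // Ax'; case: pselect => // Ay' /val_inj.
by move=> /(@inj _ _ _ f _ _ (mem_set I) (mem_set I)) [].
Qed.

(** Zorn's lemma is applied to the sets whose union with [A0] satisfies [P]; the empty chain is then
    bounded by [A0] itself. *)
Lemma Zorn_above (T : Type) (P : set (set T)) (A0 : set T) : P A0 ->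
  (forall F, F !=set0 -> F `<=` P -> total_on F subset -> P (\bigcup_(X in F) X)) ->
  exists A, [/\ P A, A0 `<=` A & forall B, P B -> A `<=` B -> B `<=` A].
Proof.
move=> PA0 Pchain.
have [|A [PA Amax]] := @Zorn_bigcup T [set X | P (A0 `|` X)].
  move=> F FP Ft; rewrite /=.
  have [->|/set0P F0] := eqVneq F set0; first by rewrite bigcup_set0 setU0.
  have -> : A0 `|` \bigcup_(X in F) X = \bigcup_(Y in [set A0 `|` X | X in F]) Y.
    rewrite bigcup_image -bigcupUr //.
  apply: Pchain.
  - by case: F0 => X FX; exists (A0 `|` X); exists X.
  - by move=> _ [X FX <-]; exact: FP.
  - move=> _ _ [X FX <-] [Y FY <-].
    by case: (Ft _ _ FX FY) => XY; [left|right]; exact: setUS.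
exists (A0 `|` A); split => // B PB AB; apply: contrapT => BA.
apply: (Amax B); last by rewrite /= (_ : _ `|` _ = B) //; apply/setUidPr => x A0x; apply: AB; left.
split; first by move=> x Ax; apply: AB; right.
by move=> BA'; apply: BA => x /BA'; right.
Qed.

(** A maximal partial injection, given by its graph [G], is defined on all of [A] or attains all of
    [B]: otherwise a pair of missing points could be added. *)
Lemma card_le_total (T U : Type) (A : set T) (B : set U) : A !=set0 -> B !=set0 ->
  (A #<= B)%card \/ (B #<= A)%card.
Proof.
move=> [a0 Aa0] [b0 Bb0].
pose P (G : set (T * U)) := [/\ forall z, G z -> A z.1 /\ B z.2,
  forall z z', G z -> G z' -> z.1 = z'.1 -> z.2 = z'.2 &
  forall z z', G z -> G z' -> z.2 = z'.2 -> z.1 = z'.1].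
have [||G [[GAB Gfun Ginj] _ Gmax]] := @Zorn_above _ P set0.
- by split.
- move=> F F0 FP Ft; split.
  + by move=> z [X FX Xz]; have [H _ _] := FP _ FX; exact: H.
  + move=> z z' [X FX Xz] [Y FY Yz']; have [_ HX _] := FP _ FX; have [_ HY _] := FP _ FY.
    case: (Ft _ _ FX FY) => XY; [apply: HY|apply: HX] => //; exact: XY.
  + move=> z z' [X FX Xz] [Y FY Yz']; have [_ _ HX] := FP _ FX; have [_ _ HY] := FP _ FY.
    case: (Ft _ _ FX FY) => XY; [apply: HY|apply: HX] => //; exact: XY.
have [domG|/existsNP[a /not_implyP[Aa Na]]] := pselect (forall a, A a -> exists b, G (a, b)).
  left; have /choice [f fE] : forall a, exists b, A a -> G (a, b).
    move=> a; have [/domG[b Gb]|?] := pselect (A a); first by exists b.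
    by exists b0.
  apply: (@card_le_injP _ _ _ f) => [x /fE /GAB[]//|x y /set_mem Ax /set_mem Ay fxy].
  exact: (Ginj _ _ (fE _ Ax) (fE _ Ay)).
right; have ranG b : B b -> exists a, G (a, b).
  move=> Bb; apply: contrapT => Nb; pose G' := G `|` [set (a, b)].
  suff PG' : P G' by apply: Na; exists b; apply: (Gmax G' PG') => [z|]; [left|right].
  split.
  - by move=> z [/GAB//|->].
  - move=> z z' [Gz|->] [Gz'|->] //=; [exact: Gfun| |] => E; case: Na.
      by exists z.2; rewrite -E -surjective_pairing.
    by exists z'.2; rewrite E -surjective_pairing.
  - move=> z z' [Gz|->] [Gz'|->] //=; [exact: Ginj| |] => E; case: Nb.
      by exists z.1; rewrite -E -surjective_pairing.
    by exists z'.1; rewrite E -surjective_pairing.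
have /choice [f fE] : forall b, exists a, B b -> G (a, b).
  move=> b; have [/ranG[a' Ga]|?] := pselect (B b); first by exists a'.
  by exists a0.
apply: (@card_le_injP _ _ _ f) => [x /fE /GAB[]//|x y /set_mem Bx /set_mem By fxy].
exact: (Gfun _ _ (fE _ Bx) (fE _ By)).
Qed.

Lemma infinite_inj_nat (T : Type) : infinite_set [set: T] -> exists f : nat -> T, injective f.
Proof.
move=> Tinf; have [t _] : [set: T] !=set0.
  by apply/set0P; apply: contra_notN Tinf => /eqP->; exact: finite_set0.
move/infiniteP : Tinf => /(card_le_inj t)[f _ fI].
by exists f => x y; apply: fI; exact: mem_set.
Qed.

(** Hessenberg's theorem that an infinite cardinal equals its square. Zorn's lemma is applied to
    graphs of injective pairings on subsets of [T]; the subset is recovered from the graph as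
    [fld G], by means of its diagonal pairs. *)
Lemma infinite_pair_inj (T : Type) : infinite_set [set: T] ->
  exists p : T * T -> T, injective p.
Proof.
move=> /infinite_inj_nat[nu nuI].
pose fld (G : set (T * T * T)) := [set a | exists c, G ((a, a), c)].
pose P (G : set (T * T * T)) := [/\
  forall z, G z -> [/\ fld G z.1.1, fld G z.1.2 & fld G z.2],
  forall a b, fld G a -> fld G b -> exists c, G ((a, b), c),
  forall z z', G z -> G z' -> z.1 = z'.1 -> z.2 = z'.2 &
  forall z z', G z -> G z' -> z.2 = z'.2 -> z.1 = z'.1].
have fldS (G H : set (T * T * T)) : G `<=` H -> fld G `<=` fld H.
  by move=> GH a [c Gc]; exists c; exact: GH.
(* Starting from a pairing on a countable subset puts all [nu n] into the field of the maximal
   graph, where they serve as tags. *)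
pose G0 : set (T * T * T) := [set ((nu n.1, nu n.2), nu (choice.pickle n)) | n in [set: nat * nat]].
have fldG0 n : fld G0 (nu n) by exists (nu (choice.pickle (n, n))), (n, n).
have [||G [[Gfld Gtot Gfun Ginj] G0G Gmax]] := @Zorn_above _ P G0.
- split.
  + by move=> _ [[n m] _ <-] /=; split.
  + by move=> _ _ [_ [n _ [<- _ _]]] [_ [m _ [<- _ _]]]; exists (nu (choice.pickle (n.1, m.1))), (n.1, m.1).
  + by move=> _ _ [[n m] _ <-] [[n' m'] _ <-] /= [/nuI-> /nuI->].
  + move=> _ _ [n _ <-] [m _ <-] /= /nuI E.
    by rewrite (pcan_inj choice.pickleK E).
- move=> F F0 FP Ft.
  have FU X : F X -> X `<=` \bigcup_(X in F) X by move=> FX z Xz; exists X.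
  have two z z' : (\bigcup_(X in F) X) z -> (\bigcup_(X in F) X) z' ->
      exists X, [/\ F X, P X, X z & X z'].
    move=> [X FX Xz] [Y FY Yz']; case: (Ft _ _ FX FY) => XY.
      by exists Y; split => //; [exact: FP|exact: XY].
    by exists X; split => //; [exact: FP|exact: XY].
  split.
  + move=> z Uz; have [X [FX [H _ _ _] Xz _]] := two _ _ Uz Uz.
    by have [? ? ?] := H _ Xz; split; apply: (fldS _ _ (FU _ FX)).
  + move=> a b [c Uac] [d Ubd]; have [X [FX [_ H _ _] Xa Xb]] := two _ _ Uac Ubd.
    have [||e Xe] := H a b; [by exists c|by exists d|].
    by exists e, X.
  + by move=> z z' Uz Uz'; have [X [FX [_ _ H _] Xz Xz']] := two _ _ Uz Uz'; exact: H.
  + by move=> z z' Uz Uz'; have [X [FX [_ _ _ H] Xz Xz']] := two _ _ Uz Uz'; exact: H.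
pose A := fld G.
have nuA n : A (nu n) by apply: (fldS _ _ G0G).
have /choice [m mE] : forall z : T * T, exists c, A z.1 -> A z.2 -> G (z, c).
  move=> [a b]; have [[Aa Ab]|N] := pselect (A a /\ A b).
    by have [c Gc] := Gtot _ _ Aa Ab; exists c.
  by exists (nu 0%N) => Aa Ab; case: N.
have mA a b : A a -> A b -> A (m (a, b)).
  by move=> Aa Ab; have [] := Gfld _ (mE (a, b) Aa Ab).
have mI a b a' b' : A a -> A b -> A a' -> A b' -> m (a, b) = m (a', b') -> (a, b) = (a', b').
  by move=> Aa Ab Aa' Ab'; exact: (Ginj _ _ (mE (a, b) Aa Ab) (mE (a', b') Aa' Ab')).
have GE z c : G (z, c) <-> [/\ A z.1, A z.2 & c = m z].
  split=> [Gzc|[A1 A2 ->]]; last exact: mE.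
  have [/= A1 A2 _] := Gfld _ Gzc; split => //.
  exact: (Gfun _ _ Gzc (mE _ A1 A2)).
have pairA (h : T -> T) : (forall x, A (h x)) -> injective h -> exists p : T * T -> T, injective p.
  move=> hA hI; exists (fun z => m (h z.1, h z.2)) => -[a b] [a' b'] /=.
  by move=> /(mI _ _ _ _ (hA _) (hA _) (hA _) (hA _)) [/hI-> /hI->].
have [C0|/set0P C0] := eqVneq (~` A) set0.
  apply: (pairA id) => // x; apply: contrapT => Ax.
  by have : (~` A) x by []; rewrite C0.
have A0 : A !=set0 by exists (nu 0%N).
(* If the complement of [A] embeds into [A], then so does all of [T], with a tag that records the
   side from which a point comes. *)
have [AC|CA] := card_le_total A0 C0; last first.
  have [f fA fI] := card_le_inj (nu 0%N) CA.
  pose g x := if `[< A x >] then x else f x.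
  have gA x : A (g x) by rewrite /g; case: asboolP => // /fA.
  apply: (pairA (fun x => m (nu `[< A x >], g x))) => [x|x y]; first exact: mA.
  move=> /(mI _ _ _ _ (nuA _) (gA _) (nuA _) (gA _)) [/nuI]; rewrite /g.
  case: asboolP => Ax; case: asboolP => Ay // _.
  by apply: fI; exact: mem_set.
(* Otherwise the complement contains a copy of [A] under [j]. The pairing extends to the union [A']:
   new pairs are coded in [A] by [q] and moved into the copy by [j]. This contradicts maximality. *)
have [j jC jI] := card_le_inj (nu 0%N) AC.
pose A' := A `|` j @` A.
pose isA x := `[< A x >].
have /choice [b bE] : forall x, exists a, A' x -> A a /\ (if isA x then x = a else x = j a).
  move=> x; have [Ax|Ax] := pselect (A x).
    by exists x => _; rewrite /isA asboolT.
  have [[a Aa <-]|N] := pselect ((j @` A) x); last by exists x => -[].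
  by exists a => _; rewrite /isA asboolF //; exact: jC.
pose tag x y := nu (choice.pickle (isA x, isA y)).
pose q x y := m (tag x y, m (b x, b y)).
have qA x y : A' x -> A' y -> A (q x y).
  by move=> /bE[Ax _] /bE[Ay _]; exact: (mA _ _ (nuA _) (mA _ _ Ax Ay)).
have qI x y x' y' : A' x -> A' y -> A' x' -> A' y' -> q x y = q x' y' -> (x, y) = (x', y').
  move=> /bE[Ax xE] /bE[Ay yE] /bE[Ax' xE'] /bE[Ay' yE'].
  move=> /(mI _ _ _ _ (nuA _) (mA _ _ Ax Ay) (nuA _) (mA _ _ Ax' Ay')) [].
  move=> /nuI/(pcan_inj choice.pickleK)[tx ty] /(mI _ _ _ _ Ax Ay Ax' Ay')[bx bb].
  move: xE yE xE' yE'; rewrite tx ty bx bb.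
  by case: ifP => _ ->; case: ifP => _ -> <- <-.
pose m' z := if isA z.1 && isA z.2 then m z else j (q z.1 z.2).
pose G' : set (T * T * T) := [set ((z.1, z.2), m' z) | z in [set z | A' z.1 /\ A' z.2]].
have fldG' x : fld G' x <-> A' x.
  split=> [[c [[y1 y2] /= [A1 _] [<- _]]]//|Ax].
  by exists (m' (x, x)), (x, x).
have jAN x : A x -> A (j x) -> False by move=> /jC.
have A'm' x y : A' x -> A' y -> A' (m' (x, y)).
  move=> Ax Ay; rewrite /m' /=; case: andP => [[/asboolP ? /asboolP ?]|_].
    by left; exact: mA.
  by right; exists (q x y) => //; exact: qA.
have PG' : P G'.
  split.
  - move=> _ [[x y] /= [Ax Ay] <-] /=; split; apply/fldG' => //; exact: A'm'.
  - by move=> x y /fldG' Ax /fldG' Ay; exists (m' (x, y)), (x, y).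
  - by move=> _ _ [[x y] _ <-] [[x' y'] _ <-] /= [-> ->].
  - move=> _ _ [[x y] [/= Ax Ay] <-] [[x' y'] [/= Ax' Ay'] <-] /=; rewrite /m' /=.
    case: andP => [[/asboolP ? /asboolP ?]|_]; case: andP => [[/asboolP ? /asboolP ?]|_].
    + exact: mI.
    + by move=> E; case: (jAN (q x' y')); [exact: qA|rewrite -E; exact: mA].
    + by move=> E; case: (jAN (q x y)); [exact: qA|rewrite E; exact: mA].
    + move=> /jI E; apply: qI => //; apply: E; apply: mem_set; exact: qA.
have GG' : G `<=` G'.
  move=> [[x y] c] /GE[/= Ax Ay ->]; exists (x, y); first by split; left.
  by rewrite /m' /isA !asboolT.
exfalso; apply: (jAN (nu 0%N) (nuA _)).
have /fldG'[c /(Gmax _ PG' GG')] : A' (j (nu 0%N)) by right; exists (nu 0%N).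
by exists c.
Qed.

(** Iterated pairing separates sequences of equal length, so the length is coded along with it. *)
Lemma infinite_seq_inj (T : Type) : infinite_set [set: T] ->
  exists p : seq T -> T, injective p.
Proof.
move=> Tinf; have [nu nuI] := infinite_inj_nat Tinf; have [p pI] := infinite_pair_inj Tinf.
pose c := foldr (fun x y => p (x, y)) (nu 0%N).
have cI s t : size s = size t -> c s = c t -> s = t.
  elim: s t => [|x s IH] [|y t] //= [st] /pI [-> /IH -> //].
by exists (fun s => p (nu (size s), c s)) => s t /pI [/nuI/cI st /st].
Qed.

(** * Product topology *)

Lemma ptws_cvgP (I : Type) (V : topologicalType) (F : set_system {ptws I -> V})
  (f : {ptws I -> V}) : Filter F ->
  F --> f <-> forall i, (fun g : {ptws I -> V} => g i) @ F --> f i.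
Proof.
move=> FF; split=> [Ff i A nA|Ff].
  apply: Ff; have /cvg_sup/(_ i) fi : f --> f by exact: cvg_id.
  apply: fi; exact: initial_continuous.
apply/cvg_sup => i A; rewrite nbhsE => -[B [[C oC <-] Cf] CA].
by apply: filterS CA _; apply: Ff; exact: open_nbhs_nbhs.
Qed.

Lemma ptws_continuous_coord (I : Type) (V : topologicalType) (i : I) :
  continuous (fun g : {ptws I -> V} => g i).
Proof. by move=> f; have /ptws_cvgP := @cvg_id _ (nbhs f); apply. Qed.

Lemma ptws_continuous (I : Type) (K V : topologicalType) (f : K -> {ptws I -> V}) :
  (forall i, continuous (fun k => f k i)) -> continuous f.
Proof. by move=> fc k; apply/ptws_cvgP => i; exact: fc. Qed.

(** The near-covering form of compactness is used with finite sequences of indices, directed by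
    inclusion, as parameters. *)
Lemma compact_seq_cover (X : topologicalType) (I : eqType) (A : set X) (O : I -> set X) :
  compact A -> (forall i, open (O i)) -> (forall x, A x -> exists i, O i x) ->
  exists s : seq I, forall x, A x -> exists2 i, i \in s & O i x.
Proof.
move=> /compact_near_coveringP Ac Oo AO.
pose F : set_system (seq I) := filter_from [set: seq I] (fun s => [set t : seq I | {subset s <= t}]).
have FF : Filter F.
  apply: filter_from_filter; first by exists [::].
  move=> s t _ _; exists (s ++ t) => // u su.
  by split=> x xs; apply: su; rewrite mem_cat xs ?orbT.
have [|s _ sP] := Ac _ F (fun s x => exists2 i, i \in s & O i x) FF.
  move=> x /AO[i Oix]; exists (O i, [set t : seq I | {subset [:: i] <= t}]).
    by split => /=; [exact: open_nbhs_nbhs|exists [:: i]].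
  by move=> [y t] [/= Oiy it]; exists i => //; apply: it; rewrite mem_head.
by exists s; exact: sP.
Qed.

Section ContinuousSum.
Variables (R : realType) (X : topologicalType).

Lemma continuous_sumr (Z : Type) (s : seq Z) (F : Z -> X -> R) :
  (forall z, continuous (F z)) -> continuous (fun x => \sum_(z <- s) F z x).
Proof.
move=> Fc x; elim: s => [|z s IH].
  rewrite (_ : (fun _ => _) = fun=> 0); first exact: cvg_cst.
  by apply/funext => y; rewrite big_nil.
rewrite (_ : (fun _ => _) = fun y => F z y + \sum_(z <- s) F z y).
  by apply: cvgD; [exact: Fc|exact: IH].
by apply/funext => y; rewrite big_cons.
Qed.

Lemma continuous_scale_sumr (a : R) (Z : Type) (s : seq Z) (F : Z -> X -> R) (c : Z -> R) :
  (forall z, continuous (F z)) -> continuous (fun x => a * \sum_(z <- s) `|F z x - c z|).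
Proof.
move=> Fc x; apply: cvgM; first exact: cvg_cst.
apply: continuous_sumr => z y; apply: cvg_norm; apply: cvgB; last exact: cvg_cst.
exact: Fc.
Qed.

End ContinuousSum.

(** * The compact cube and its bump functions *)

Section Cube.
Variables (R : realType) (J : choiceType).
Local Notation T := {ptws J -> R}.

Lemma hausdorff_ptws : hausdorff_space T.
Proof. by apply: (@hausdorff_product J (fun=> R)) => _; exact: Rhausdorff. Qed.

Lemma compact_cube : compact (@cube R J).
Proof.
have -> : @cube R J = [set f : T | forall i, (`[0, 1]%classic : set R) (f i)].
  by apply/seteqP; split=> f /= fC i; have := fC i; rewrite in_itv /= => /andP.
exact: (@tychonoff J (fun=> R) (fun=> `[0, 1]%classic) (fun=> @segment_compact _ _ _)).
Qed.

Lemma closed_cube : closed (@cube R J).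
Proof. exact: compact_closed hausdorff_ptws compact_cube. Qed.

Lemma nbhs_ptws (x : T) (A : set T) : nbhs x A -> exists (s : seq J) (e : R),
  0 < e /\ forall y : T, (forall j, j \in s -> `|y j - x j| < e) -> A y.
Proof.
pose F : set_system T := filter_from [set se : seq J * R | 0 < se.2]
  (fun se => [set y | forall j, j \in se.1 -> `|y j - x j| < se.2]).
have FF : Filter F.
  apply: filter_from_filter; first by exists ([::], 1) => /=.
  move=> [s e] [t d] /= e0 d0; exists (s ++ t, Num.min e d) => /=; first by rewrite lt_min e0.
  move=> y H; split=> j js; have := H j; rewrite mem_cat js ?orbT lt_min => /(_ isT) /andP[//].
have Fx : F --> x.
  apply/ptws_cvgP => j; apply/cvgrPdist_lt => e e0.
  exists ([:: j], e) => //= y; rewrite distrC; apply; exact: mem_head.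
by move=> /Fx [[s e] /= e0 sA]; exists s, e.
Qed.

(* The centres are rational, so that there are no more bumps than finite
   sequences of coordinates. *)
Definition bumpf (p : seq (J * rat) * nat) (x : T) : R :=
  p.2%:R * \sum_(z <- p.1) `|x z.1 - ratr z.2|.

Lemma continuous_bumpf p : continuous (bumpf p).
Proof.
by apply: (@continuous_scale_sumr R T _ _ _ (fun z x => x z.1)) => z; exact: ptws_continuous_coord.
Qed.

(** A substitute for Urysohn functions: the bump is small at [x] and at least 1 off [A]. Rational
    centres may preclude the value 0 at [x], but any fixed small bound suffices for the folds. *)
Lemma bumpf_separation (x : T) (A : set T) : nbhs x A ->
  exists p, bumpf p x < 1 / 8 /\ forall y, bumpf p y < 1 -> A y.
Proof.
move=> /nbhs_ptws [s [e [e0 sA]]].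
(* The scale [n] turns [bumpf p y < 1] into a distance below [1/n] from [y j] to its centre, which
   lies within [d <= 1/n] of [x j]; hence [2/n < e]. The remaining factors of [d] keep the bump at
   [x] below [1/8]. *)
pose n := (Num.truncn (2 / e)).+1.
have n0 : 0 < n%:R :> R by rewrite ltr0n.
have ne : 2 / n%:R < e.
  by rewrite ltr_pdivrMr // mulrC -ltr_pdivrMr //; exact: truncnS_gt.
pose d := 1 / (8 * n%:R * (size s).+1%:R) : R.
have d0 : 0 < d by rewrite divr_gt0 // !mulr_gt0 // ltr0n.
have /choice [q qP] j : exists q : rat, `|x j - ratr q| < d.
  have [|q] := @rat_in_itvoo R (x j - d) (x j + d); first by lra.
  by rewrite in_itv /= => qd; exists q; rewrite ltr_distlC; lra.
exists ([seq (j, q j) | j <- s], n); rewrite /bumpf /= !big_map; split.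
  have : \sum_(j <- s) `|x j - ratr (q j)| <= \sum_(j <- s) d.
    by apply: ler_sum => j _; exact: ltW.
  rewrite big_const_seq count_predT iter_addr_0 => sd.
  have : n%:R * \sum_(j <- s) `|x j - ratr (q j)| <= n%:R * (d *+ size s).
    by rewrite ler_pM2l.
  move/le_lt_trans; apply.
  have -> : n%:R * (d *+ size s) = (1 / 8) * ((size s)%:R / (size s).+1%:R).
    rewrite -(mulr_natr d (size s)) /d; field.
    by rewrite !lt0r_neq0 ?ltr0n.
  by rewrite gtr_pMr ?divr_gt0 // ltr_pdivrMr ?ltr0n // mul1r ltr_nat.
move=> y; rewrite big_map => yn; apply: sA => j js.
have yj : `|y j - ratr (q j)| < 1 / n%:R.
  rewrite ltr_pdivlMr // mulrC; apply: le_lt_trans yn; rewrite ler_pM2l //.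
  by rewrite (big_rem j) //= lerDl sumr_ge0.
have dn : d <= 1 / n%:R.
  rewrite /d !mul1r lef_pV2 ?posrE ?mulr_gt0 ?ltr0n //.
  have : 1 <= (size s).+1%:R :> R by rewrite ler1n.
  by nra.
have := ler_distD (ratr (q j)) (y j) (x j); rewrite (distrC (ratr (q j)) (x j)).
have := qP j; have : 2 / n%:R = 1 / n%:R + 1 / n%:R :> R by rewrite -mulrDl.
by lra.
Qed.

End Cube.

(** * Opposite faces of the cube *)

Section Faces.
Variables (R : realType) (J : choiceType).
Local Notation T := {ptws J -> R}.

Definition face (j : J) (c : R) : set T := [set x | cube x /\ x j = c].

Definition separates_faces (j : J) (U V : set T) : Prop :=
  [/\ open U, open V, U `&` V = set0, face j 0 `<=` U & face j 1 `<=` V].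

Lemma nbhs_box (s : seq J) (e : R) (p : T) : 0 < e ->
  nbhs p [set y : T | forall j, j \in s -> `|y j - p j| < e].
Proof.
move=> e0; elim: s => [|j s IH]; first by apply: filterS filterT.
have pj : nbhs p [set y : T | `|y j - p j| < e].
  have /cvgrPdist_lt /(_ _ e0) := @ptws_continuous_coord J R j p.
  by apply: filterS => y; rewrite distrC.
apply: filterS2 pj IH => y yj ys k; rewrite inE => /predU1P[->//|]; exact: ys.
Qed.

(** Kuhn's lemma on ever finer grids gives cells that have, for each coordinate in [s], a vertex
    inside [U] and one outside. A cluster point of these cells is not in [U j], as a small cell
    nearby would lie in [U j], nor in [V j], as such a cell has a vertex in [U j]. *)
Lemma faces_not_covered_finite (s : seq J) (U V : J -> set T) :
  (forall j, separates_faces j (U j) (V j)) ->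
  exists2 x : T, cube x & forall j, j \in s -> ~ U j x /\ ~ V j x.
Proof.
move=> UV.
(* Coordinates outside [s] are set to 0, and [minn] keeps the images of all lattice points in the
   cube. *)
pose emb N (v : seq_sub s -> nat) : T := fun j =>
  if insub j is Some i then (minn (v i) N.+1)%:R / N.+1%:R else 0.
have embE N v (i : seq_sub s) : emb N v (ssval i) = (minn (v i) N.+1)%:R / N.+1%:R.
  rewrite /emb; case: insubP => [u _ /val_inj -> //|]; by rewrite (valP i).
have embC N v : cube (emb N v).
  move=> j; rewrite /emb; case: insubP => [u _ _|_]; last by rewrite lexx ler01.
  by rewrite divr_ge0 // ler_pdivrMr ?ltr0n // mul1r ler_nat geq_minr.
have emb_close N v w : (forall i, (v i < N.+1)%N) ->
    (forall i, (v i <= w i <= (v i).+1)%N) -> forall j, `|emb N w j - emb N v j| <= N.+1%:R^-1.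
  move=> vN vw j; rewrite /emb; case: insubP => [u _ _|_]; last by rewrite subrr normr0 invr_ge0.
  rewrite -mulrBl normrM (ger0_norm (x := _^-1)) // ler_piMl // ?invr_ge0 //.
  have := vN u; have := vw u => wE vE.
  rewrite -natrB; last by lia.
  by rewrite ger0_norm // lern1; lia.
have vE : forall N : nat, exists v : seq_sub s -> nat, (forall i, (v i < N.+1)%N) /\
    forall i : seq_sub s, exists w w', [/\ forall j, (v j <= w j <= (v j).+1)%N,
      forall j, (v j <= w' j <= (v j).+1)%N, ~ U (ssval i) (emb N w) & U (ssval i) (emb N w')].
  move=> N; pose f (i : seq_sub s) w := `[< ~ U (ssval i) (emb N w) >].
  have [| |v [vN vf]] := @kuhn_cube (seq_sub s) N.+1 f.
  - move=> i w wi; apply/negP => /asboolP; apply.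
    have [_ _ _ + _] := UV (ssval i); apply; split => //.
    by rewrite embE wi min0n mul0r.
  - move=> i w wi; apply/asboolP => Uw.
    have [_ _ UV0 _ FV] := UV (ssval i).
    suff : (U (ssval i) `&` V (ssval i)) (emb N w) by rewrite UV0.
    split => //; apply: FV; split => //.
    by rewrite embE wi minnn divff.
  exists v; split => // i; have [w [w' [wv w'v /asboolP fw /asboolP/contrapT fw']]] := vf i.
  by exists w, w'.
have [v vP] := choice vE.
pose x N := emb N (v N).
have [|p [pC pcl]] := @compact_cube R J (x @ \oo) _.
  by apply: (@nearW _ \oo) => N; exact: embC.
(* Arbitrarily fine cells have their lowest corner [x N] near [p], so one of them lies wholly in
   [O]. *)
have key (O : set T) : nbhs p O -> exists N, forall w,
    (forall i, (v N i <= w i <= (v N i).+1)%N) -> O (emb N w).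
  move=> /nbhs_ptws [t [e [e0 tO]]].
  pose N0 := Num.truncn (2 / e).
  have e20 : 0 < e / 2 by rewrite divr_gt0.
  have [|_ [[N /= N0N <-] pN]] := pcl (x @` [set N | (N0 <= N)%N]) _ _ (nbhs_box t p e20).
    by exists N0 => // N /= N0N; exists N.
  exists N => w vw; apply: tO => j jt.
  have [vN _] := vP N; have := emb_close _ _ _ vN vw j; have := pN j jt.
  have : N.+1%:R^-1 < e / 2.
    rewrite invf_plt ?posrE ?divr_gt0 ?ltr0n // invf_div.
    apply: lt_le_trans (truncnS_gt _) _; by rewrite ler_nat ltnS.
  have := ler_distD (x N j) (emb N w j) (p j); rewrite -/(x N).
  by move: (N.+1%:R^-1) => u; lra.
exists p => // j js; pose i : seq_sub s := SeqSub js.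
have [oU oV UV0 _ _] := UV j.
split=> [Uj|Vj].
  have [N Nw] := key _ (open_nbhs_nbhs (conj oU Uj)).
  have [_ /(_ i) [w [_ [wv _ Uw _]]]] := vP N.
  by apply: Uw; exact: Nw.
have [N Nw] := key _ (open_nbhs_nbhs (conj oV Vj)).
have [_ /(_ i) [_ [w [_ wv _ Uw]]]] := vP N.
suff : (U j `&` V j) (emb N w) by rewrite UV0.
by split => //; exact: Nw.
Qed.

(** By compactness a cover of the cube would involve only finitely many coordinates. *)
Lemma faces_not_covered (U V : J -> set T) :
  (forall j, separates_faces j (U j) (V j)) ->
  exists2 x : T, cube x & forall j, ~ U j x /\ ~ V j x.
Proof.
move=> UV; apply: contrapT => N.
have [|x xC|s sC] := compact_seq_cover (O := fun j => U j `|` V j) (@compact_cube R J).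
- by move=> j; have [? ? _ _ _] := UV j; exact: openU.
- apply: contrapT => Nx; apply: N; exists x => // j.
  by split=> H; apply: Nx; exists j; [left|right].
have [x /sC [j js UVx] /(_ j js)] := faces_not_covered_finite s UV.
by case: UVx => H [].
Qed.

End Faces.

(** * Separation of disjoint compact sets by open sets *)

Section SeparationOfCompacts.
Variable X : topologicalType.

Definition open_separated (A B : set X) : Prop := exists O W : set X,
  [/\ open O, open W, O `&` W = set0, A `<=` O & B `<=` W].

Lemma open_separatedC A B : open_separated A B -> open_separated B A.
Proof. by move=> [P [W [oO oW OW AO BW]]]; exists W, P; rewrite setIC. Qed.

Lemma open_separated_compact A B : compact B ->
  (forall b, B b -> open_separated A [set b]) -> open_separated A B.
Proof.
move=> Bc AB.
have /choice [OW OWP] : forall b, exists OW : set X * set X, [/\ open OW.1, open OW.2,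
    OW.1 `&` OW.2 = set0, A `<=` OW.1 & B b -> OW.2 b].
  move=> b; have [/AB [P [W [oO oW dOW AO BW]]]|Bb] := pselect (B b).
    by exists (P, W); split => // _; exact: BW.
  by exists (setT, set0); split => //=; [exact: openT|exact: open0|rewrite setI0].
have [|b Bb|s sP] := compact_seq_cover (O := fun b => (OW b).2) Bc.
- by move=> b; have [] := OWP b.
- by exists b; have [_ _ _ _ +] := OWP b; apply.
exists [set x | forall b, b \in s -> (OW b).1 x], (\bigcup_(b in [set` s]) (OW b).2); split.
- elim: s {sP} => [|b s IH].
    rewrite (_ : mkset _ = setT); first exact: openT.
    by apply/seteqP; split => // x _ b; rewrite in_nil.
  rewrite (_ : mkset _ = (OW b).1 `&` [set x | forall b, b \in s -> (OW b).1 x]).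
    by apply: openI => //; have [] := OWP b.
  apply/seteqP; split=> x /=.
    by move=> H; split=> [|c cs]; apply: H; rewrite inE ?eqxx ?cs ?orbT.
  by move=> [Hb Hs] c; rewrite inE => /predU1P[->//|]; exact: Hs.
- by apply: bigcup_open => b _; have [] := OWP b.
- apply/seteqP; split=> // x [/= xO [b bs xb]].
  suff : ((OW b).1 `&` (OW b).2) x by have [_ _ -> _ _] := OWP b.
  by split => //; exact: xO.
- by move=> x Ax b _; have [_ _ _ + _] := OWP b; apply.
- by move=> x /sP[b bs xb]; exists b.
Qed.

(** Compactness of both sets stands in for normality, which a product of uncountably many lines does
    not have. *)
Lemma compact_open_separated A B : hausdorff_space X -> compact A -> compact B ->
  A `&` B = set0 -> open_separated A B.
Proof.
move=> Xh Ac Bc AB; apply: open_separated_compact => // b Bb.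
apply: open_separatedC; apply: open_separated_compact => // a Aa.
have ba : b != a.
  by apply: contraPneq AB => ba; apply/eqP/set0P; exists a; split=> //; rewrite -ba.
move: Xh; rewrite open_hausdorff => /(_ _ _ ba) [[P W] /= [/set_mem Ob /set_mem Wa] [oO oW /eqP OW]].
by exists P, W; split => // _ ->.
Qed.

End SeparationOfCompacts.

(** * The folded set *)

Section RealFunctions.
Variables (R : realType) (X : topologicalType).
Implicit Types f h : X -> R.

Lemma open_lt_continuous f c : continuous f -> open [set x | f x < c].
Proof. by move=> fc; apply: (open_comp (f := f) (D := [set y | y < c])) => // x _; exact: fc. Qed.

Lemma open_gt_continuous f c : continuous f -> open [set x | c < f x].
Proof. by move=> fc; apply: (open_comp (f := f) (D := [set y | c < y])) => // x _; exact: fc. Qed.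

Lemma continuous_minB f h (c : R) : continuous f -> continuous h ->
  continuous (fun x => Num.min (f x) c - Num.min (h x) c).
Proof.
move=> fc hc x; apply: cvgB.
  by apply: (@continuous_min R X f (fun=> c)); [exact: fc|exact: cvg_cst].
by apply: (@continuous_min R X h (fun=> c)); [exact: hc|exact: cvg_cst].
Qed.

Lemma connected_image_interval f (A : set X) : continuous f -> connected A ->
  is_interval (f @` A).
Proof.
move=> fc Ac; apply/connected_intervalP.
by apply: connected_continuous_connected => //; exact: continuous_subspaceT.
Qed.

End RealFunctions.

Section Zigzag.
Variables (R : realType) (I : choiceType).
Local Notation J := (I + I)%type.
Local Notation T := {ptws J -> R}.
Variable pr : I -> (seq (J * rat) * nat) * (seq (J * rat) * nat).

Definition level (a : I) (x : T) : R := x (inr a).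

(** Values lie between -1 and 1: near -1 where the first bump is small and the second at least 1,
    near 1 in the opposite case. *)
Definition spread (a : I) (x : T) : R :=
  Num.min (bumpf (pr a).1 x) 1 - Num.min (bumpf (pr a).2 x) 1.

(* The complement of [below a `|` above a] is the preimage under
   [(spread a, level a)] of a broken line in the plane, shaped like the letter Z
   turned over, with horizontal parts at heights 1/4, 1/2, 3/4. *)
Definition below (a : I) : set T := [set x |
  level a x < 1/4] `|` ([set x | 1/2 < spread a x] `&` [set x | level a x < 3/4])
  `|` ([set x | 1/2 < level a x] `&` [set x | level a x < 3/4] `&` [set x | - (1/2) < spread a x]).

Definition above (a : I) : set T := [set x |
  3/4 < level a x] `|` ([set x | spread a x < - (1/2)] `&` [set x | 1/4 < level a x])
  `|` ([set x | 1/4 < level a x] `&` [set x | level a x < 1/2] `&` [set x | spread a x < 1/2]).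

Lemma level_continuous a : continuous (level a).
Proof. exact: ptws_continuous_coord. Qed.

Lemma spread_continuous a : continuous (spread a).
Proof. by apply: continuous_minB; exact: continuous_bumpf. Qed.

Let lc := level_continuous.
Let sc := spread_continuous.

Lemma separates_faces_zigzag a : separates_faces (inr a) (below a) (above a).
Proof.
split.
- by do ?[apply: openU|apply: openI]; first [apply: open_lt_continuous|apply: open_gt_continuous].
- by do ?[apply: openU|apply: openI]; first [apply: open_lt_continuous|apply: open_gt_continuous].
- apply/seteqP; split=> // x [].
  rewrite /below /above /= => -[[H1|[H1 H2]]|[[H1 H2] H3]] [[H4|[H4 H5]]|[[H4 H5] H6]]; lra.
- by move=> x [_ x0]; left; left; rewrite /= /level x0; lra.
- by move=> x [_ x1]; left; left; rewrite /= /level x1; lra.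
Qed.

Definition crooked : set T :=
  [set x | cube x /\ forall a, ~ below a x /\ ~ above a x].

Lemma closed_crooked : closed crooked.
Proof.
have -> : crooked = @cube R J `&` \bigcap_a (~` (below a `|` above a)).
  apply/seteqP; split=> x [xC xN]; split => // a.
    by move=> _ []; have [] := xN a.
  by have /not_orP := xN a Logic.I.
apply: closedI; first exact: closed_cube.
apply: closed_bigI => a _; apply: open_closedC.
by have [? ? _ _ _] := separates_faces_zigzag a; exact: openU.
Qed.

Lemma crooked_low a x : crooked x -> spread a x < 1/2 -> level a x <= 1/4 \/ 1/2 <= level a x.
Proof.
move=> [_ /(_ a) [_ N]] s; have [|?] := leP (level a x) (1/4); first by left.
by right; rewrite leNgt; apply/negP => ?; apply: N; right.
Qed.

Lemma crooked_high a x : crooked x -> - (1/2) < spread a x -> level a x <= 1/2 \/ 3/4 <= level a x.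
Proof.
move=> [_ /(_ a) [N _]] s; have [|?] := leP (level a x) (1/2); first by left.
by right; rewrite leNgt; apply/negP => ?; apply: N; right.
Qed.

Lemma crooked_left a x : crooked x -> spread a x < - (1/2) -> level a x <= 1/4.
Proof.
by move=> [_ /(_ a) [_ N]] s; rewrite leNgt; apply/negP => ?; apply: N; left; right.
Qed.

Lemma crooked_right a x : crooked x -> 1/2 < spread a x -> 3/4 <= level a x.
Proof.
by move=> [_ /(_ a) [N _]] s; rewrite leNgt; apply/negP => ?; apply: N; left; right.
Qed.

Hypothesis pr_surj : forall p, exists a, pr a = p.

(** If [c] lies only in [P] and [d] only in [Q], take the fold for bumps that tell [c] from [Q] and
    [d] from [P]. It forces [c] to a low level and [d] to a high one, while [P] and [Q] each have to
    avoid a band of levels in between; a common point [p] is then impossible. *)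
Lemma crooked_comparable (P Q : set T) (p : T) : P `<=` crooked -> Q `<=` crooked ->
  compact P -> compact Q -> connected P -> connected Q -> P p -> Q p ->
  P `<=` Q \/ Q `<=` P.
Proof.
move=> Pk Qk Pc Qc Pco Qco Pp Qp; apply: contrapT => /not_orP [].
move=> /existsNP[c /not_implyP[Pc' Qc']] /existsNP[d /not_implyP[Qd Pd]].
have nC (A : set T) x : compact A -> ~ A x -> nbhs x (~` A).
  move=> Ac Ax; apply: open_nbhs_nbhs; split => //; apply: closed_openC.
  by apply: compact_closed => //; exact: hausdorff_ptws.
(* [u] is small at [c] and at least 1 on [Q]; [v] is small at [d] and at least 1 on [P]. Hence
   [spread] is at most 0 on [P] and at least 0 on [Q]. *)
have [u [uc uQ]] := bumpf_separation (nC _ _ Qc Qc').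
have [v [vd vP]] := bumpf_separation (nC _ _ Pc Pd).
have {}uQ x : Q x -> 1 <= bumpf u x by move=> Qx; rewrite leNgt; apply/negP => /uQ.
have {}vP x : P x -> 1 <= bumpf v x by move=> Px; rewrite leNgt; apply/negP => /vP.
have [a aE] := pr_surj (u, v).
have sE x : spread a x = Num.min (bumpf u x) 1 - Num.min (bumpf v x) 1 by rewrite /spread aE.
have m1 (y : R) : Num.min y 1 <= 1 by rewrite ge_min lexx orbT.
have m0 (y : R) : Num.min y 1 <= y by rewrite ge_min lexx.
have sP x : P x -> spread a x < 1/2.
  by move=> /vP v1; rewrite sE (min_idPr v1); have := m1 (bumpf u x); lra.
have sQ x : Q x -> - (1/2) < spread a x.
  by move=> /uQ u1; rewrite sE (min_idPr u1); have := m1 (bumpf v x); lra.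
have lc1 : level a c <= 1/4.
  apply: crooked_left; first exact: Pk.
  rewrite sE (min_idPr (vP _ Pc')); have := m0 (bumpf u c); lra.
have ld : 3/4 <= level a d.
  apply: crooked_right; first exact: Qk.
  rewrite sE (min_idPr (uQ _ Qd)); have := m0 (bumpf v d); lra.
(* If [p] is low, [Q] joins it to [d] across the level 5/8, forbidden on [Q]; otherwise [P] joins
   [c] to [p] across 3/8, forbidden on [P]. *)
have [lp|lp] := crooked_low (Pk _ Pp) (sP _ Pp).
  have /connected_image_interval := Qco; move=> /(_ _ _ (@lc a)) /(_ _ _ (imageP _ Qp) (imageP _ Qd) (5/8)).
  case=> [|x Qx xE]; first by apply/andP; split; lra.
  by have := crooked_high (Qk _ Qx) (sQ _ Qx); rewrite xE; lra.
have /connected_image_interval := Pco; move=> /(_ _ _ (@lc a)) /(_ _ _ (imageP _ Pc') (imageP _ Pp) (3/8)).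
case=> [|x Px xE]; first by apply/andP; split; lra.
by have := crooked_low (Pk _ Px) (sP _ Px); rewrite xE; lra.
Qed.

End Zigzag.

(** * Essential sets *)

Lemma chain_seq_sup (T : Type) (F : set (set T)) (s : seq (set T)) : F !=set0 ->
  total_on F subset -> exists2 X, F X & forall Y, F Y -> Y \in s -> Y `<=` X.
Proof.
move=> [X0 FX0] Ft; elim: s => [|Y s [X FX XP]]; first by exists X0.
have [FY|FY] := pselect (F Y); last first.
  by exists X => // Z FZ; rewrite inE => /predU1P[ZY|]; [rewrite ZY in FZ|exact: XP].
case: (Ft _ _ FX FY) => XY.
  exists Y => // Z FZ; rewrite inE => /predU1P[->//|Zs]; exact: subset_trans (XP _ FZ Zs) XY.
by exists X => // Z FZ; rewrite inE => /predU1P[->//|Zs]; exact: XP.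
Qed.

Section EssentialSets.
Variables (R : realType) (I : choiceType).
Local Notation J := (I + I)%type.
Local Notation T := {ptws J -> R}.

(* [Y] meets the intersection of any partitions of the cube between the pairs of
   opposite faces with index [inl i]. *)
Definition essential_set (Y : set T) : Prop := forall U V : I -> set T,
  (forall i, separates_faces (inl i) (U i) (V i)) ->
  exists2 y, Y y & forall i, ~ U i y /\ ~ V i y.

(** The folds are partitions for the coordinates [inr a]; together with given ones for the
    coordinates [inl i] they have a common point in the cube. *)
Lemma essential_set_crooked pr : essential_set (@crooked R I pr).
Proof.
move=> U V UV.
have [|x xC xN] := @faces_not_covered R J
    (fun j => match j with inl i => U i | inr a => below pr a end)
    (fun j => match j with inl i => V i | inr a => above pr a end).
  by case=> [i|a]; [exact: UV|exact: separates_faces_zigzag].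
exists x; last by move=> i; exact: (xN (inl i)).
by split => // a; exact: (xN (inr a)).
Qed.

Lemma essential_set_chain (F : set (set T)) (C : set T) : compact C -> F !=set0 ->
  total_on F subset ->
  (forall X, F X -> [/\ open X, ~` X `<=` C & essential_set (~` X)]) ->
  essential_set (~` (\bigcup_(X in F) X)).
Proof.
move=> Cc F0 Ft FP U V UV; apply: contrapT => N.
pose O (k : set T + I) := match k with
  | inl X => if `[< F X >] then X else set0 | inr i => U i `|` V i end.
have [|x Cx|s sC] := compact_seq_cover (O := O) Cc.
- case=> [X|i] /=; first by case: asboolP => [/FP[]//|_]; exact: open0.
  by have [? ? _ _ _] := UV i; exact: openU.
- apply: contrapT => Nx; apply: N; exists x.
    by move=> [X FX Xx]; apply: Nx; exists (inl X) => /=; rewrite asboolT.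
  by move=> i; split=> H; apply: Nx; exists (inr i); [left|right].
have [X FX XP] := chain_seq_sup (pmap (fun k => if k is inl X then Some X else None) s) F0 Ft.
have [oX XC /(_ U V UV)[y Xy yN]] := FP _ FX.
have [[Y|i] ks] := sC _ (XC _ Xy); last by case; case: (yN i).
rewrite /=; case: asboolP => // FY Yy; apply: Xy; apply: XP Yy => //.
by rewrite mem_pmap; apply/mapP; exists (inl Y).
Qed.

(** Partitions that witness the failure on [P] and on [Q] could be glued to witness the failure on
    the union. *)
Lemma essential_setU (P Q : set T) : compact P -> compact Q -> P `&` Q = set0 ->
  essential_set (P `|` Q) -> essential_set P \/ essential_set Q.
Proof.
move=> Pc Qc PQ PQe; apply: contrapT => /not_orP[].
have bad (Y : set T) : ~ essential_set Y -> exists U V : I -> set T,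
    (forall i, separates_faces (inl i) (U i) (V i)) /\
    forall y, Y y -> exists i, U i y \/ V i y.
  move=> /existsNP[U /existsNP[V /not_implyP[UV N]]]; exists U, V; split => // y Yy.
  apply: contrapT => Ny; apply: N; exists y => // i.
  by split=> H; apply: Ny; exists i; [left|right].
move=> /bad[U [V [UV UVP]]] /bad[U' [V' [UV' UVQ]]].
have [A [B [oA oB AB PA QB]]] := compact_open_separated (@hausdorff_ptws R J) Pc Qc PQ.
(* The first family is used near [P], the second near [Q]; their common part is added so as to
   contain the faces. *)
pose mix (X X' : I -> set T) i := (X i `&` X' i) `|` (X i `&` A) `|` (X' i `&` B).
have disj (X Y : set T) x : X `&` Y = set0 -> X x -> Y x -> False.
  by move=> XY Xx Yx; have : (X `&` Y) x by []; rewrite XY.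
have [|y PQy yN] := PQe (mix U U') (mix V V').
  move=> i; have [oU oV dUV AU BV] := UV i; have [oU' oV' dUV' AU' BV'] := UV' i.
  split.
  - by do ?[apply: openU|apply: openI].
  - by do ?[apply: openU|apply: openI].
  - apply/seteqP; split=> // x [] [[[Ux Ux']|[Ux Ax]]|[Ux' Bx]] [[[Vx Vx']|[Vx Ax']]|[Vx' Bx']];
      by [apply: (disj _ _ x dUV)|apply: (disj _ _ x dUV')|apply: (disj _ _ x AB)].
  - by move=> x Ax; left; left; split; [exact: AU|exact: AU'].
  - by move=> x Bx; left; left; split; [exact: BV|exact: BV'].
case: PQy => [Py|Qy].
  have [i [Uy|Vy]] := UVP _ Py; have [NU NV] := yN i.
    by apply: NU; left; right; split => //; exact: PA.
  by apply: NV; left; right; split => //; exact: PA.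
have [i [Uy|Vy]] := UVQ _ Qy; have [NU NV] := yN i.
  by apply: NU; right; split => //; exact: QB.
by apply: NV; right; split => //; exact: QB.
Qed.

(** A minimal closed essential set, found through its maximal open complement, is connected: if it
    fell into two closed pieces, one of them would be essential, against minimality. *)
Lemma essential_subcontinuum (C : set T) : compact C -> essential_set C ->
  exists K : set T, [/\ K `<=` C, compact K, connected K & essential_set K].
Proof.
move=> Cc Ce; have Th := @hausdorff_ptws R J.
pose P (X : set T) := [/\ open X, ~` X `<=` C & essential_set (~` X)].
have [||X [[oX XC Xe] _ Xmax]] := @Zorn_above _ P (~` C).
- split; [by apply: closed_openC; exact: compact_closed|by rewrite setCK|by rewrite setCK].
- move=> F F0 FP Ft; split.
  + by apply: bigcup_open => X /FP[].
  + case: (F0) => X FX x Nx; have [_ + _] := FP _ FX; apply => Xx.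
    by apply: Nx; exists X.
  + exact: (essential_set_chain Cc).
have Kcl : closed (~` X) by exact: open_closedC.
have Kc : compact (~` X) by exact: subclosed_compact XC.
exists (~` X); split => //; apply: contrapT => /connectedPn[E [E0 EU [E1 E2]]].
have E01 := separated_disjoint (conj E1 E2).
have EX b : E b `<=` ~` X by move=> x Ex; rewrite EU; case: b Ex; [right|left].
have Ecl b : closed (E b).
  have -> : E b = closure (E b); last exact: closed_closure.
  apply/seteqP; split; first exact: subset_closure.
  move=> x cx; have : (~` X) x.
    by rewrite (closure_id (~` X)).1 //; exact: closureS (EX b) x cx.
  rewrite EU; case: b cx => cx [] //.
    by move=> Ex; have : (E false `&` closure (E true)) x by []; rewrite E2.
  by move=> Ex; have : (closure (E false) `&` E true) x by []; rewrite E1.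
have Ec b : compact (E b) by exact: subclosed_compact (EX b).
have [b Eb] : exists b, essential_set (E b).
  have := essential_setU (Ec false) (Ec true) E01; rewrite -EU => /(_ Xe).
  by case=> H; [exists false|exists true].
have [y Ey] := E0 (~~ b).
have /(_ y) : ~` E b `<=` X.
  apply: Xmax => [|x Xx Ex]; last exact: EX Ex Xx.
  by split; rewrite ?setCK //; [exact: closed_openC|exact: subset_trans (EX b) XC].
have Nb : ~ E b y.
  move=> Eby; have : (E false `&` E true) y by case: b Ey Eby {Eb}.
  by rewrite E01.
by move=> /(_ Nb); exact: EX Ey.
Qed.

End EssentialSets.

(** * Subspaces and weight *)

Section Subtype.
Variables (X : topologicalType) (K : set X).
Local Notation vK := (@set_val X K).

Lemma set_val_continuous : continuous vK.
Proof. exact: initial_continuous. Qed.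

Lemma open_set_type (A : set K) : open A -> exists2 B : set X, open B & A = vK @^-1` B.
Proof. by move=> [B oB <-]; exists B. Qed.

Lemma closed_set_type (A : set K) : closed A -> exists2 B : set X, closed B & A = vK @^-1` B.
Proof.
move=> /closed_openC/open_set_type[B oB AB]; exists (~` B); first exact: open_closedC.
by apply/seteqP; split=> k; rewrite /= -[A]setCK AB.
Qed.

Lemma compact_set_type : compact K -> compact [set: K].
Proof.
move=> Kc F FF _.
have [|x [Kx xcl]] := Kc (vK @ F) _.
  by apply: (@nearW _ F) => k; exact: set_valP.
exists (exist _ x (mem_set Kx)); split => // A B FA.
rewrite nbhsE => -[C [/open_set_type[D oD ->] Dx] CB].
have FvA : F (vK @^-1` (vK @` A)) by apply: filterS FA => k Ak; exists k.
have [_ [[k Ak <-] Dk]] := xcl (vK @` A) D FvA (open_nbhs_nbhs (conj oD Dx)).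
by exists k; split => //; exact: CB.
Qed.

Lemma hausdorff_set_type : hausdorff_space X -> hausdorff_space K.
Proof.
move=> Xh x y xy; apply: val_inj; apply: Xh => A B nA nB.
have [k [Ak Bk]] := xy _ _ (set_val_continuous nA) (set_val_continuous nB).
by exists (vK k).
Qed.

Lemma connected_set_type : connected K -> connected [set: K].
Proof.
move=> Kco A [a Aa] [C oC AC] [D cD AD].
have [C' oC' CE] := open_set_type oC; have [D' cD' DE] := closed_set_type cD.
have Kval x : K x -> exists k : K, vK k = x.
  by move=> Kx; exists (exist _ x (mem_set Kx)).
have : vK @` A = K.
  apply: Kco; first by exists (vK a), a.
  - exists C' => //; rewrite AC CE setTI; apply/seteqP; split=> [_ [k Ck <-]|x [/Kval[k <-] Cx]].
      by split => //; exact: set_valP.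
    by exists k.
  - exists D' => //; rewrite AD DE setTI; apply/seteqP; split=> [_ [k Ck <-]|x [/Kval[k <-] Cx]].
      by split => //; exact: set_valP.
    by exists k.
move=> AK; apply/seteqP; split => // k _.
have : (vK @` A) (vK k) by rewrite AK; exact: set_valP.
by move=> [l Al /val_inj <-].
Qed.

Lemma compact_image_set_val (A : set K) : compact A -> compact (vK @` A).
Proof.
by apply: continuous_compact; apply: continuous_subspaceT; exact: set_val_continuous.
Qed.

Lemma connected_image_set_val (A : set K) : connected A -> connected (vK @` A).
Proof.
move=> Ac; apply: (@connected_continuous_connected K X A vK Ac).
exact: continuous_subspaceT set_val_continuous.
Qed.

End Subtype.

(** * Bases and the weight of a subspace *)

Section Weight.
Variables (R : realType) (J : choiceType) (K : set {ptws J -> R}).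

Lemma basis_bumpf : basis [set [set k : K | bumpf p (set_val k) < 1] | p in [set: seq (J * rat) * nat]].
Proof.
split=> [_ [p _ <-]|k A].
  apply: (@open_lt_continuous R K (@bumpf R J p \o set_val)) => k.
  by apply: continuous_comp; [exact: set_val_continuous|exact: continuous_bumpf].
rewrite nbhsE => -[B [/open_set_type[C oC ->] Ck] BA].
have [p [pk pC]] := bumpf_separation (open_nbhs_nbhs (conj oC Ck)).
exists [set k : K | bumpf p (set_val k) < 1].
  by split; [exists p|rewrite /=; lra].
by move=> l /pC Cl; exact: BA.
Qed.

End Weight.

(** A finite [B] has only finitely many finite subfamilies, too few for [I]; an infinite [B] has no
    more finite sequences than members. *)
Lemma finite_families_card_ge (I : Type) (X : choiceType) (B : set X) (s : I -> seq X) :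
  infinite_set [set: I] -> (forall i b, b \in s i -> B b) ->
  (forall i j, s i =i s j -> i = j) -> ([set: I] #<= B)%card.
Proof.
move=> Iinf sB sI.
have [Bfin|Binf] := pselect (finite_set B).
  exfalso; apply: Iinf; have [F FE] := (finite_fsetP).1 Bfin.
  suff le : ([set: I] #<= [set` fpowerset F])%card.
    exact: card_le_finite le (finite_fset _).
  apply: (@card_le_injP _ _ _ (fun i => seq_fset tt (s i))) => [i _|i j _ _ sij].
    suff : seq_fset tt (s i) \in fpowerset F by [].
    rewrite fpowersetE; apply/fsubsetP => b.
    by rewrite seq_fsetE => /sB; rewrite FE.
  by apply: sI => b; rewrite -(seq_fsetE tt (s i)) -(seq_fsetE tt (s j)) sij.
have /infinite_seq_inj[e eI] : infinite_set [set: B].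
  by move=> Bf; apply: Binf; rewrite -(eq_finite_set (card_setT B)).
have /choice [t tE] : forall i, exists t : seq B, [seq set_val b | b <- t] = s i.
  move=> i; have : forall b, b \in s i -> B b by exact: sB.
  elim: (s i) => [|b u IH] bB; first by exists [::].
  have [v <-] : exists v : seq B, [seq set_val c | c <- v] = u.
    by apply: IH => c cu; apply: bB; rewrite inE cu orbT.
  by exists (exist _ b (mem_set (bB _ (mem_head _ _))) :: v).
apply: (@card_le_injP _ _ _ (fun i => set_val (e (t i)))) => [i _|i j _ _ /val_inj/eI tij].
  exact: set_valP.
by apply: sI => b; rewrite -!tE tij.
Qed.

(* Finitely many members of a basis cover the compact set [f i = 0] inside the
   open set [f i < 1/2], and the chosen finite families differ for different [i]. *)
Lemma basis_card_ge (R : realType) (I : choiceType) (K : topologicalType) (f : I -> K -> R)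
  (B : set (set K)) : infinite_set [set: I] -> compact [set: K] ->
  (forall i, continuous (f i)) ->
  (forall i j, i != j -> exists k, f i k = 0 /\ f j k = 1) ->
  basis B -> ([set: I] #<= B)%card.
Proof.
move=> Iinf Kc fc fsep [Bo Bb].
have /choice [s sP] : forall i, exists s : seq (set K),
    (forall b, b \in s -> B b /\ b `<=` [set k | f i k < 1/2]) /\
    forall k, f i k = 0 -> exists2 b, b \in s & b k.
  move=> i; pose O b := if `[< B b /\ b `<=` [set k | f i k < 1/2] >] then b else set0.
  have cf0 : compact [set k | f i k = 0].
    apply: subclosed_compact Kc _ => //.
    rewrite (_ : mkset _ = ~` ([set k | f i k < 0] `|` [set k | 0 < f i k])).
      apply: open_closedC; apply: openU.
        exact: open_lt_continuous.
      exact: open_gt_continuous.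
    apply/seteqP; split=> k /=; first by move=> -> [] /=; rewrite ltxx.
    by move=> /not_orP[/negP a /negP b]; apply/eqP; rewrite eq_le !leNgt a b.
  have [|k k0|s sP] := compact_seq_cover (O := O) cf0.
  - by move=> b; rewrite /O; case: asboolP => [[/Bo]//|_]; exact: open0.
  - have nk : nbhs k [set k | f i k < 1/2].
      apply: open_nbhs_nbhs; split; first exact: open_lt_continuous.
      by rewrite /= k0; lra.
    by have [b [Bb' bk] bi] := Bb _ _ nk; exists b; rewrite /O asboolT.
  exists [seq b <- s | `[< B b /\ b `<=` [set k | f i k < 1/2] >]]; split.
    by move=> b; rewrite mem_filter => /andP[/asboolP].
  move=> k /sP[b bs]; rewrite /O; case: asboolP => // bB bk; exists b => //.
  by rewrite mem_filter bs asboolT.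
have sI i j : s i =i s j -> i = j.
  move=> sij; apply/eqP/negP => /negP ij; have [k [k0 k1]] := fsep _ _ ij.
  have [b bs bk] := (sP i).2 _ k0; rewrite sij in bs.
  by have [_ /(_ _ bk)] := (sP j).1 _ bs; rewrite /= k1; lra.
exact: (finite_families_card_ge Iinf (fun i b bs => ((sP i).1 b bs).1) sI).
Qed.

(** * The essential map *)

(** Bounds the number of bumps, both for the weight and for giving every pair of bumps a coordinate
    of its own. *)
Lemma infinite_bump_index_inj (I : Type) : infinite_set [set: I] ->
  exists h : seq ((I + I) * rat) * nat -> I, injective h.
Proof.
move=> Iinf; have [nu nuI] := infinite_inj_nat Iinf.
have [p pI] := infinite_pair_inj Iinf; have [c cI] := infinite_seq_inj Iinf.
pose d (z : I + I) := match z with inl i => p (nu 0%N, i) | inr i => p (nu 1%N, i) end.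
have dI : injective d by move=> [i|i] [j|j] /= /pI [] // => [->|/nuI|/nuI|->].
pose r (z : (I + I) * rat) := p (d z.1, nu (choice.pickle z.2)).
have rI : injective r by move=> [i q] [j q'] /pI [/dI/= -> /nuI/(pcan_inj choice.pickleK)/= ->].
exists (fun z => p (c (map r z.1), nu z.2)) => -[s n] [t m] /= /pI[/cI/(inj_map rI) -> /nuI ->] //.
Qed.

Section EssentialMap.
Variables (R : realType) (I : choiceType).
Local Notation J := (I + I)%type.
Local Notation T := {ptws J -> R}.
Variable K : set T.
Hypotheses (Kcube : K `<=` @cube R J) (Kc : compact K) (Ke : essential_set K).

Let Th := @hausdorff_ptws R J.

(** If all coordinates of the target are strictly between 0 and 1, the half-spaces on either side of
    each of them separate the faces, and a point of [K] outside them all lies over the target. Such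
    targets are dense in the cube, and the image of [K] is closed. *)
Lemma essential_set_onto (c : {ptws I -> R}) : cube c ->
  exists2 x, K x & (fun i => x (inl i)) = c.
Proof.
have int (d : I -> R) : (forall i, 0 < d i < 1) -> exists2 x, K x & (fun i => x (inl i)) = d.
  move=> d01; have [|x Kx xN] := @Ke (fun i => [set x | x (inl i) < d i]) (fun i => [set x | d i < x (inl i)]).
    move=> i; have /andP[d0 d1] := d01 i; split.
    - by apply: open_lt_continuous; exact: ptws_continuous_coord.
    - by apply: open_gt_continuous; exact: ptws_continuous_coord.
    - by apply/seteqP; split=> // x [/= a b]; have := lt_trans a b; rewrite ltxx.
    - by move=> x [_ /= ->].
    - by move=> x [_ /= ->].
  exists x => //; apply/funext => i; have [/negP a /negP b] := xN i.
  by apply/eqP; rewrite eq_le !leNgt a b.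
pose g (x : T) : {ptws I -> R} := fun i => x (inl i).
have gc : continuous g by apply: ptws_continuous => i; exact: ptws_continuous_coord.
have gKcl : closed (g @` K).
  apply: compact_closed; first exact: hausdorff_ptws.
  by apply: continuous_compact => //; exact: continuous_subspaceT.
move=> cC; apply: contrapT => Nc.
have /nbhs_ptws[s [e [e0 sN]]] : nbhs c (~` (g @` K)).
  apply: open_nbhs_nbhs; split; first exact: closed_openC.
  by move=> [x Kx xc]; apply: Nc; exists x.
pose e1 := Num.min e 1.
have e1e : e1 <= e by rewrite /e1 ge_min lexx.
have e11 : e1 <= 1 by rewrite /e1 ge_min lexx orbT.
have e10 : 0 < e1 by rewrite /e1 lt_min e0 ltr01.
(* Each coordinate moves towards 1/2 by at most [e1 / 2], and thus off the end points of the
   interval. *)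
pose d : I -> R := fun i => c i + e1 * (1/2 - c i).
have [|x Kx xd] := int d.
  by move=> i; have [? ?] := cC i; rewrite /d; apply/andP; split; nra.
apply: (sN d); last by exists x.
move=> j _; have [? ?] := cC j; rewrite /d addrC addKr.
by rewrite ltr_norml; apply/andP; split; nra.
Qed.

(** Partitions here live in [K], whereas [essential_set] speaks of open sets in the whole product.
    If partitions in [K] had no common point, their sides would cover [K]; by compactness they
    shrink to compact sets that still cover [K] and can be separated in the product. *)
Lemma essential_map_coords :
  essential_map (fun k : K => (fun i => set_val k (inl i)) : {ptws I -> R}).
Proof.
have coordc i : continuous (fun k : K => set_val k (inl i)).
  move=> k; apply: (@continuous_comp K T R set_val (fun x : T => x (inl i))).
    exact: set_val_continuous.
  exact: (@ptws_continuous_coord J R (inl i)).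
have clc i c : closed [set k : K | set_val k (inl i) = c].
  rewrite (_ : mkset _ = ~` ([set k : K | set_val k (inl i) < c] `|` [set k : K | c < set_val k (inl i)])).
    by apply: open_closedC; apply: openU;
      [apply: open_lt_continuous|apply: open_gt_continuous]; exact: coordc.
  apply/seteqP; split=> k /=; first by move=> -> [] /=; rewrite ltxx.
  by move=> /not_orP[/negP a /negP b]; apply/eqP; rewrite eq_le !leNgt a b.
split=> [i|L LP].
  split; [exact: clc|exact: clc|].
  by apply/seteqP; split=> // k [/= -> /eqP]; rewrite eq_sym oner_eq0.
apply: contrapT => N.
(* Open sets of the product that trace the two sides of [L i] on [K]; they are only known to be
   disjoint within [K]. *)
have /choice [W WP] : forall i, exists W : bool -> set T, [/\ forall b, open (W b),
    forall x, K x -> W false x -> W true x -> False,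
    forall k : K, ~ L i k -> exists b, W b (set_val k),
    face (inl i) 0 `&` K `<=` W false & face (inl i) 1 `&` K `<=` W true].
  move=> i; have [_ [U [V [[oU oV] UV LUV AU BV]]]] := LP i.
  have [U' oU' UE] := open_set_type oU; have [V' oV' VE] := open_set_type oV.
  exists (fun b => if b then V' else U'); split; first by case.
  - move=> x Kx Ux Vx; have : (U `&` V) (exist _ x (mem_set Kx)) by rewrite UE VE.
    by rewrite UV.
  - move=> k Lk; have : (~` L i) k by [].
    by rewrite LUV UE VE => -[?|?]; [exists false|exists true].
  - move=> x [[_ x0] Kx]; have : U (exist _ x (mem_set Kx)) by exact: AU.
    by rewrite UE.
  - move=> x [[_ x1] Kx]; have : V (exist _ x (mem_set Kx)) by exact: BV.
    by rewrite VE.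
(* [OC k]: an open neighbourhood of [k] whose trace on [K] lies in a compact set
   that is contained in a single [W i b]. *)
have /choice [OC OCP] : forall k : K, exists OC : set T * set T * (I * bool),
    [/\ open OC.1.1, OC.1.1 (set_val k), compact OC.1.2, K `&` OC.1.1 `<=` OC.1.2 &
    OC.1.2 `<=` K `&` W OC.2.1 OC.2.2].
  move=> k; have [i [b Wk]] : exists i b, W i b (set_val k).
    apply: contrapT => Nk; apply: N; exists k => i _; apply: contrapT => Lk.
    by have [_ _ /(_ _ Lk)[b ?] _ _] := WP i; apply: Nk; exists i, b.
  have oW : open (W i b) by have [+ _ _ _ _] := WP i; apply.
  have [||A [B [oA oB AB Ak BW]]] := @compact_open_separated T [set set_val k] (K `&` ~` W i b) Th (@compact_set1 _ _).
  - by apply: compact_closedI => //; exact: open_closedC.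
  - by apply/seteqP; split=> // x [/= -> [_]].
  exists (A, K `&` ~` B, (i, b)); split => //=.
  - exact: Ak.
  - by apply: compact_closedI => //; exact: open_closedC.
  - by move=> x [Kx Ax]; split => // Bx; have : (A `&` B) x by []; rewrite AB.
  - move=> x [Kx Bx]; split => //; apply: contrapT => Wx; apply: Bx; exact: BW.
have [k|k _|s sK] := compact_seq_cover (O := fun k : K => set_val @^-1` (OC k).1.1) (compact_set_type Kc).
- by have [oO _ _ _ _] := OCP k; exists (OC k).1.1.
- by exists k; have [] := OCP k.
(* The finitely many compact pieces, sorted by the side that contains them. *)
pose F i b := \big[setU/set0]_(k <- s | (OC k).2 == (i, b)) (OC k).1.2.
have FW i b : F i b `<=` K `&` W i b.
  rewrite /F; elim/big_ind : _ => [x []|A B AW BW x [/AW|/BW]|k /eqP kib] //.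
  by have [_ _ _ _] := OCP k; rewrite kib.
have Fc i b : compact (F i b) by apply: bigsetU_compact => k _; have [] := OCP k.
have facec i c : compact (@face R J (inl i) c).
  rewrite (_ : face _ _ = @cube R J `&` ~` ([set x : T | x (inl i) < c] `|` [set x : T | c < x (inl i)])).
    apply: compact_closedI; first exact: compact_cube.
    by apply: open_closedC; apply: openU;
      [apply: open_lt_continuous|apply: open_gt_continuous]; exact: ptws_continuous_coord.
  apply/seteqP; split=> x [xC]; first by move=> xc; split => //; rewrite /= xc ltxx => -[].
  by move=> /not_orP[/negP a /negP b]; split => //; apply/eqP; rewrite eq_le !leNgt a b.
(* Joining the opposite faces to the pieces gives disjoint compact sets, whose separating
   neighbourhoods are admissible for [essential_set]. *)
have /choice [UV UVP] : forall i, exists UV : set T * set T,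
    [/\ separates_faces (inl i) UV.1 UV.2, F i false `<=` UV.1 & F i true `<=` UV.2].
  move=> i; have [_ WFT _ W0 W1] := WP i.
  have [|||U [V [oU oV UVd AU BV]]] := @compact_open_separated T
      (face (inl i) 0 `|` F i false) (face (inl i) 1 `|` F i true) Th.
  - exact: compactU.
  - exact: compactU.
  - apply/seteqP; split=> // x [] [[xC0 x0]|/FW[Kx Wx]] [[xC x1]|/FW[Kx' Wx']].
    + by move: x1; rewrite x0 => /eqP; rewrite eq_sym oner_eq0.
    + by apply: (WFT x Kx' _ Wx'); apply: W0; split.
    + by apply: (WFT x Kx Wx); apply: W1; split.
    + exact: (WFT x).
  exists (U, V); split; first split => //=.
  - by move=> x Ax; apply: AU; left.
  - by move=> x Ax; apply: BV; left.
  - by move=> x Ax; apply: AU; right.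
  - by move=> x Ax; apply: BV; right.
have [|y Ky yN] := @Ke (fun i => (UV i).1) (fun i => (UV i).2).
  by move=> i; have [] := UVP i.
have [k ks Oky] := sK (exist _ y (mem_set Ky)) Logic.I.
have [_ _ _ OK _] := OCP k.
have : F (OC k).2.1 (OC k).2.2 y.
  rewrite /F (big_rem k) //= -surjective_pairing eqxx; left.
  exact: OK.
case: (OC k).2 => i b /=; have [_ U0 U1] := UVP i; have [NU NV] := yN i.
by case: b => [/U1|/U0].
Qed.

End EssentialMap.

Theorem theorem4p1 (R : realType) (I : Type) (Iinf : infinite_set [set: I]) :
  exists (K : topologicalType) (f : K -> {ptws I -> R}),
    [/\ continuum K /\ hereditarily_indecomposable K, has_weight K I,
        continuous f, f @` [set: K] = @cube R I & essential_map f].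
Proof.
elim/Pchoice: I => I in Iinf *.
have [h hI] := infinite_bump_index_inj Iinf; have [p pI] := infinite_pair_inj Iinf.
(* [pr] is a left inverse of the injective coding of pairs of bumps by elements of [I], with an
   arbitrary value off its range; hence it is surjective. *)
have /choice [pr prE] : forall a : I, exists q : (seq ((I + I) * rat) * nat) * (seq ((I + I) * rat) * nat),
    forall q', p (h q'.1, h q'.2) = a -> q' = q.
  move=> a; have [[q qa]|N] := pselect (exists q, p (h q.1, h q.2) = a).
    exists q => -[u v]; rewrite -qa => /pI[/hI-> /hI->].
    by rewrite -surjective_pairing.
  by exists (([::], 0%N), ([::], 0%N)) => q' q'a; case: N; exists q'.
have pr_surj q : exists a, pr a = q by exists (p (h q.1, h q.2)); rewrite -(prE _ q).
have Th := @hausdorff_ptws R (I + I)%type.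
have Cc : compact (@crooked R I pr).
  by apply: subclosed_compact (@compact_cube R _) _; [exact: closed_crooked|move=> x []].
have [K [KC Kc Kco Ke]] := essential_subcontinuum Cc (@essential_set_crooked R I pr).
have Kcube : K `<=` @cube R (I + I)%type by move=> x /KC[].
pose f (k : K) : {ptws I -> R} := fun i => set_val k (inl i).
have fcoord i : continuous (fun k => f k i).
  move=> k; apply: (@continuous_comp K _ R set_val (fun x : {ptws (I + I)%type -> R} => x (inl i))).
    exact: set_val_continuous.
  exact: (@ptws_continuous_coord _ R (inl i)).
have fK : f @` [set: K] = @cube R I.
  apply/seteqP; split=> [_ [k _ <-] i|c /(essential_set_onto Kc Ke)[x Kx xc]].
    exact: Kcube (set_valP k) (inl i).
  by exists (exist _ x (mem_set Kx)).
exists K, f; split => //.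
- split; first by split; [exact: compact_set_type|split; [exact: connected_set_type|exact: hausdorff_set_type]].
  move=> C D [Cc' Cco] [Dc Dco] [k [Ck Dk]].
  have subK (A : set K) : set_val @` A `<=` crooked pr by move=> _ [l _ <-]; exact/KC/set_valP.
  have inj_sub (A B : set K) : set_val @` A `<=` set_val @` B -> A `<=` B.
    by move=> AB l Al; have [|m Bm /val_inj <-] := AB (set_val l); first by exists l.
  have [||||||CD|DC] := @crooked_comparable R I pr pr_surj (set_val @` C) (set_val @` D) (set_val k) (subK C) (subK D).
  + exact: compact_image_set_val.
  + exact: compact_image_set_val.
  + exact: connected_image_set_val.
  + exact: connected_image_set_val.
  + by exists k.
  + by exists k.
  + by left; exact: inj_sub.
  + by right; exact: inj_sub.
- split=> [|B Bb].
    exists [set [set k : K | bumpf q (set_val k) < 1] | q in [set: seq ((I + I) * rat) * nat]]; last exact: basis_bumpf.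
    apply: card_le_trans (card_image_le _ _) _.
    by apply: (@card_le_injP _ _ _ h) => // x y _ _; exact: hI.
  apply: (@basis_card_ge R I K (fun i k => f k i)) Bb => //; first exact: compact_set_type.
  (* Surjectivity of [f] lifts to [K] the point whose coordinate is 0 at [i] and 1 elsewhere. *)
  move=> i j ij; pose c : {ptws I -> R} := fun l => if l == i then 0 else 1.
  have : @cube R I c by move=> l; rewrite /c; case: ifP => _; rewrite ?lexx ?ler01.
  rewrite -fK => -[k _ kc]; exists k; rewrite kc /c eqxx; split => //.
  by rewrite eq_sym (negbTE ij).
- exact: ptws_continuous.
- exact: essential_map_coords.
Qed.
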